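(* Let $k$ be a field of characteristic zero, $R=k[x_1,\ldots,x_n]$, and let $\mathbf{f}=\{f_1,\ldots,f_m\}\subset R$ be a set of distinct monomials of degree $2$ whose associated graph $\mathcal{G}(\mathbf{f})$ is a connected bipartite graph. Then $\mathbf{f}$ is polarizable.
   Context: $\mathcal{G}(\mathbf{f})$ is the graph (loops allowed; a bipartite graph has none) with vertices $x_1,\ldots,x_n$ and an edge joining $x_i$ and $x_j$ exactly when $x_ix_j\in\mathbf{f}$. Polarizability. Let $P\subset k[T_1,\ldots,T_m]$ be the kernel of the $k$-algebra map $k[T_1,\ldots,T_m]\to R$, $T_j\mapsto f_j$. Put $\mathcal{Z}=\{(r_1,\ldots,r_m)\in R^m : \sum_{j} r_j\,\partial f_j/\partial x_i=0 \text{ for all } i=1,\ldots,n\}$, and let $\mathcal{P}\subset\mathcal{Z}$ be the $R$-submodule generated by the vectors $\left(\frac{\partial F}{\partial T_1}(\mathbf{f}),\ldots,\frac{\partial F}{\partial T_m}(\mathbf{f})\right)$, $F\in P$. The set $\mathbf{f}$ is polarizable if $\mathcal{P}=\mathcal{Z}$. *)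

(* Defs.v *)
From mathcomp Require Import all_boot all_order all_algebra.
From mathcomp Require Import mpoly.

Set Implicit Arguments.
Unset Strict Implicit.
Unset Printing Implicit Defensive.

Import GRing.Theory.
Local Open Scope ring_scope.

Definition monomial_of_degree2 (k : fieldType) (n : nat) (p : {mpoly k[n]}) : Prop :=
  exists2 mu : 'X_{1..n}, mdeg mu = 2%N & p = 'X_[mu].

Definition monomial_graph (k : fieldType) (n m : nat)
    (f : m.-tuple {mpoly k[n]}) : rel 'I_n :=
  fun i j => 'X_i * 'X_j \in f.

Definition connected_graph (T : finType) (e : rel T) : Prop :=
  forall x y : T, connect e x y.

(* A proper 2-colouring; it excludes loops. *)
Definition bipartite_graph (T : finType) (e : rel T) : Prop :=
  exists c : T -> bool, forall x y : T, e x y -> c x != c y.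

Section Polarizability.

Variables (k : fieldType) (n m : nat) (f : m.-tuple {mpoly k[n]}).

Definition relation_ideal (F : {mpoly k[m]}) : Prop := F \mPo f = 0.

Definition differential_syzygy (r : 'rV[{mpoly k[n]}]_m) : Prop :=
  forall i : 'I_n, \sum_(j < m) r 0 j * (tnth f j)^`M(i) = 0.

Definition relation_gradient (F : {mpoly k[m]}) : 'rV[{mpoly k[n]}]_m :=
  \row_j (F^`M(j) \mPo f).

Definition polar_syzygy (r : 'rV[{mpoly k[n]}]_m) : Prop :=
  exists (s : nat) (F : 'I_s -> {mpoly k[m]}) (a : 'I_s -> {mpoly k[n]}),
    (forall l, relation_ideal (F l)) /\
    r = \sum_(l < s) a l *: relation_gradient (F l).

Definition polarizable : Prop :=
  forall r : 'rV[{mpoly k[n]}]_m, polar_syzygy r <-> differential_syzygy r.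

End Polarizability.

(* Main.v *)
Require Import Defs.
From mathcomp Require Import all_boot all_order all_algebra.
From mathcomp Require Import mpoly.
From mathcomp Require Import ring.

Set Implicit Arguments.
Unset Strict Implicit.
Unset Printing Implicit Defensive.

Import GRing.Theory.
Local Open Scope ring_scope.

(** Every polar syzygy is a differential syzygy by the chain rule.  For the
    converse, colour the vertices so that each f_j is x_{a_j} x_{b_j} with a_j
    of the first colour and b_j of the second.  By Euler's identity
    x_v (df_j/dx_v) = f_j when v is an end of the edge j (and 0 otherwise), a
    vector r is a differential syzygy exactly when the products q_j = r_j f_j
    sum to zero over the edges at each vertex
    ([differential_syzygy_incidence]).  This condition holds separately for
    each monomial X^w, so one may assume q_j = c_j X^w with scalars c_j that
    sum to zero at each vertex and vanish unless both ends of j divide X^w.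

    Such weights c are reduced to zero one even cycle at a time.  If c_{j0} is
    nonzero, the ends of j0 are still joined by a path of edges of nonzero
    weight other than j0 ([connect_deleted_edge]): otherwise, on the component
    of b_{j0}, the weights at the two colours would differ by c_{j0} although
    both total zero.  A simple such path closes up with j0 to an even cycle
    ([alternating_cycle]).  Taking its edges alternately gives monomials
    T^al and T^be in the edge variables, both evaluating at f to the product
    of the vertices of the cycle, which divides X^w because these vertices are
    distinct.  The gradient of the relation T^al - T^be, scaled to degree w, is
    a polar syzygy with weights al_j - be_j, and subtracting c_{j0} times it
    kills the weight of j0 without creating a new nonzero weight
    ([homogeneous_syzygy_polar]). *)

(** * Monomials *)

Lemma mpolyX_neq0 (R : nzRingType) (n : nat) (w : 'X_{1..n}) :
  'X_[w] != 0 :> {mpoly R[n]}.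
Proof. by rewrite -msupp_eq0 msuppX. Qed.

Lemma mdeg2_mnm1D n (mu : 'X_{1..n}) : mdeg mu = 2%N ->
  exists i j : 'I_n, mu = (U_(i) + U_(j))%MM.
Proof.
move=> mu2; have [i mui | mu0] := pickP (fun i => (0 < mu i)%N); last first.
  suff mu_0 : mu = 0%MM by rewrite mu_0 mdeg0 in mu2.
  by apply/mnmP => i; rewrite mnm0E; move: (mu0 i); case: (mu i).
have le : (U_(i) <= mu)%MM.
  by apply/mnm_lepP => l; rewrite mnm1E; case: eqP => // <-.
have /eqP/mdeg1P [j /eqP muj] : mdeg (mu - U_(i)) = 1%N.
  by apply/eqP; rewrite -(eqn_add2r 1) -{1}(mdeg1 i) -mdegD submK // mu2.
by exists j, i; rewrite -muj submK.
Qed.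

(** Distinctness matters: w may have exponent one at every entry of s. *)
Lemma mprodX_uniq_dvd (R : nzRingType) (n : nat) (s : seq 'I_n)
    (w : 'X_{1..n}) : uniq s ->
    (forall x, x \in s -> (0 < w x)%N) ->
  exists g : {mpoly R[n]}, 'X_[w] = g * \prod_(x <- s) 'X_x.
Proof.
move=> us hs; rewrite mprodXE; set u := (\big[_/_]_(_ <- _) _)%MM.
exists 'X_[w - u]; rewrite -mpolyXD submK //; apply/mnm_lepP => i.
rewrite mnm_sumE; under eq_bigr => x _ do rewrite mnm1E.
case si: (i \in s); last first.
  rewrite big_seq big1 // => x xs; case: eqP => // xi.
  by rewrite -xi xs in si.
rewrite (bigD1_seq i) //= eqxx big1 ?addn0 ?hs // => x /negPf -> //.
Qed.

Lemma mderivXU (R : nzRingType) (n : nat) (i l : 'I_n) :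
  ('X_l : {mpoly R[n]})^`M(i) = (l == i)%:R.
Proof.
rewrite mderivX mnm1E; case: eqP => [->|]; last by rewrite scale0r.
by rewrite -{1}[U_(i)%MM]add0m addmK mpolyX0 scale1r.
Qed.

(** * The chain rule for polynomial composition *)

Section ChainRule.

Variables (R : comNzRingType) (n m : nat) (f : m.-tuple {mpoly R[n]}).

(** The polynomials satisfying the chain rule contain the constants and the
    variables and are closed under sums and products. *)
Lemma mderiv_comp_mpoly (i : 'I_n) (F : {mpoly R[m]}) :
  (F \mPo f)^`M(i) = \sum_(j < m) (F^`M(j) \mPo f) * (tnth f j)^`M(i).
Proof.
pose chain (G : {mpoly R[m]}) :=
  (G \mPo f)^`M(i) = \sum_(j < m) (G^`M(j) \mPo f) * (tnth f j)^`M(i).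
have chainC (c : R) : chain c%:MP.
  rewrite /chain comp_mpolyC mderivC big1 // => j _.
  by rewrite mderivC comp_mpoly0 mul0r.
have chainM G H : chain G -> chain H -> chain (G * H).
  rewrite /chain => hG hH; rewrite rmorphM mderivM hG hH mulr_suml mulr_sumr.
  rewrite -big_split; apply: eq_bigr => j _ /=.
  by rewrite mderivM comp_mpolyD !rmorphM /=; ring.
have chainX j : chain 'X_j.
  rewrite /chain comp_mpolyXU -tnth_nth (bigD1 j) //= big1 => [|l /negPf lj].
    by rewrite mderivXU eqxx comp_mpoly1 mul1r addr0.
  by rewrite mderivXU eq_sym lj comp_mpoly0 mul0r.
have chain1 : chain 1 by rewrite -mpolyC1; exact: chainC.
elim/mpolyind: F => [|c mu p _ _ hp]; first by rewrite -mpolyC0; exact: chainC.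
suff hmu : chain 'X_[mu].
  rewrite -mul_mpolyC comp_mpolyD mderivD hp; have := chainM _ _ (chainC c) hmu.
  rewrite /chain => ->; rewrite -big_split; apply: eq_bigr => j _ /=.
  by rewrite mderivD comp_mpolyD mulrDl.
rewrite mpolyXE_id; apply: (big_ind chain chain1 chainM) => j _.
elim: (mu j) => [|e he]; first by rewrite expr0.
by rewrite exprS; exact: (chainM _ _ (chainX j) he).
Qed.

(** Euler's identity for the monomial T^mu, evaluated at f; multiplying by f_j
    avoids dividing T^mu by T_j. *)
Lemma mul_comp_mderivX (mu : 'X_{1..m}) (j : 'I_m) :
  ('X_[mu]^`M(j) \mPo f) * tnth f j = (mu j)%:R *: ('X_[mu] \mPo f).
Proof.
rewrite mderivX comp_mpolyZ -scalerAl; case: (posnP (mu j)) => [->|mu_gt0].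
  by rewrite !scale0r.
congr (_ *: _); rewrite (tnth_nth 0) -comp_mpolyXU -rmorphM /= -mpolyXD submK //.
by apply/mnm_lepP => l; rewrite mnm1E; case: eqP => // <-.
Qed.

End ChainRule.

(** * Polar syzygies *)

Section PolarModule.

Variables (k : fieldType) (n m : nat) (f : m.-tuple {mpoly k[n]}).
Implicit Types r s : 'rV[{mpoly k[n]}]_m.

Lemma polar_syzygy0 : polar_syzygy f 0.
Proof. by exists 0, (fun=> 0), (fun=> 0); split=> [[]//|]; rewrite big_ord0. Qed.

Lemma polar_syzygyD r s :
  polar_syzygy f r -> polar_syzygy f s -> polar_syzygy f (r + s).
Proof.
case=> p [F [a [F0 ->]]] [q [G [b [G0 ->]]]].
exists (p + q)%N.
exists (fun l => match split l with inl i => F i | inr i => G i end).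
exists (fun l => match split l with inl i => a i | inr i => b i end).
split=> [l|]; first by case: split.
rewrite [RHS]big_split_ord /=; apply: (congr2 +%R); apply: eq_bigr => i _.
  by rewrite -[lshift q i]/(unsplit (inl i)) unsplitK.
by rewrite -[rshift p i]/(unsplit (inr i)) unsplitK.
Qed.

Lemma polar_syzygy_sum (I : Type) (t : seq I) (P : pred I)
    (r : I -> 'rV[{mpoly k[n]}]_m) :
  (forall i, polar_syzygy f (r i)) -> polar_syzygy f (\sum_(i <- t | P i) r i).
Proof. by move=> hr; apply: big_ind => //; [exact: polar_syzygy0|exact: polar_syzygyD]. Qed.

Lemma polar_syzygy_gradient (F : {mpoly k[m]}) (a : {mpoly k[n]}) :
  relation_ideal f F -> polar_syzygy f (a *: relation_gradient f F).
Proof.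
by move=> F0; exists 1, (fun=> F), (fun=> a); split=> //; rewrite big_ord1.
Qed.

(** Differentiating the relation F(f) = 0 with the chain rule. *)
Lemma polar_syzygy_differential r : polar_syzygy f r -> differential_syzygy f r.
Proof.
case=> s [F [a [F0 ->]]] i.
under eq_bigr => j _ do rewrite summxE mulr_suml.
rewrite exchange_big big1 // => l _ /=.
under eq_bigr => j _ do rewrite !mxE -mulrA.
by rewrite -mulr_sumr -mderiv_comp_mpoly (F0 l) mderiv0 mulr0.
Qed.

Lemma differential_syzygyD r s : differential_syzygy f r ->
  differential_syzygy f s -> differential_syzygy f (r + s).
Proof.
move=> hr hs i; under eq_bigr => j _ do rewrite mxE mulrDl.
by rewrite big_split /= hr hs addr0.
Qed.

End PolarModule.

(** * Balanced edge weights on a bipartite multigraph *)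

Section BalancedWeights.

Variables (V E : finType) (a b : E -> V).

Definition joined (S : pred E) : rel V := fun x y =>
  [exists j, S j && ((x == a j) && (y == b j) || (x == b j) && (y == a j))].

(** Let K be the component of b j0 once j0 is removed.  Every other edge of
    nonzero weight has both ends in K or neither, so if a j0 were outside K, the
    sums of c over the edges with a-end in K and over those with b-end in K, both
    zero, would differ by exactly c j0. *)
Lemma connect_deleted_edge (A : zmodType) (c : E -> A) (j0 : E) :
    (forall v, \sum_(j | a j == v) c j = 0) ->
    (forall v, \sum_(j | b j == v) c j = 0) -> c j0 != 0 ->
  connect (joined [pred j | (c j != 0) && (j != j0)]) (b j0) (a j0).
Proof.
set S := [pred j | _] => ca cb c0.
apply: contraNT c0 => unconn; set K := connect (joined S) (b j0).
have sumK (g : E -> V) : (forall v, \sum_(j | g j == v) c j = 0) ->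
    \sum_(j | K (g j)) c j = 0.
  move=> cg; rewrite (partition_big g K) //= big1 // => v Kv.
  rewrite -[RHS](cg v); apply: eq_bigl => j.
  by case: eqP => [->|]; rewrite ?andbT ?andbF.
have K_edge j : c j != 0 -> j != j0 -> K (a j) = K (b j).
  move=> cj jj0; have Sj : S j by rewrite /= cj.
  have ab : joined S (a j) (b j) by apply/existsP; exists j; rewrite Sj !eqxx.
  have ba : joined S (b j) (a j).
    by apply/existsP; exists j; rewrite Sj !eqxx orbT.
  by apply/idP/idP => h; apply: connect_trans h (connect1 _).
have := sumK b cb; rewrite (bigD1 j0) /=; last exact: connect0.
suff -> : \sum_(j | K (b j) && (j != j0)) c j = 0 by rewrite addr0 => ->.
rewrite -[RHS](sumK a ca) [LHS]big_mkcond [RHS]big_mkcond; apply: eq_bigr => j _.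
have [->|jj0] := eqVneq j j0; first by rewrite andbF [K _](negPf unconn).
by rewrite andbT; have [->|cj] := eqVneq (c j) 0; [rewrite !if_same|rewrite K_edge].
Qed.

End BalancedWeights.

(** * Syzygies of bipartite monomials *)

Section BipartiteMonomials.

Variables (k : fieldType) (n m : nat) (f : m.-tuple {mpoly k[n]}).
Variables (a b : 'I_m -> 'I_n) (col : 'I_n -> bool).
Hypothesis fE : forall j, tnth f j = 'X_(a j) * 'X_(b j).
Hypothesis col_a : forall j, col (a j).
Hypothesis col_b : forall j, col (b j) = false.

Lemma edge_monomial_neq0 j : tnth f j != 0.
Proof. by rewrite fE -mpolyXD mpolyX_neq0. Qed.

(** Multiplying the equation at v by x_v turns each derivative of f_j into f_j
    or 0.  The equation then involves only a-ends or only b-ends, according to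
    the colour of v. *)
Lemma differential_syzygy_incidence r :
  differential_syzygy f r <->
  forall v, \sum_(j | a j == v) r 0 j * tnth f j = 0 /\
            \sum_(j | b j == v) r 0 j * tnth f j = 0.
Proof.
have dX (i v : 'I_n) : ('X_i : {mpoly k[n]})^`M(v) * 'X_v = (i == v)%:R * 'X_i.
  by rewrite mderivXU; case: eqP => [->|_]; rewrite ?mul0r.
have euler v : (\sum_(j < m) r 0 j * (tnth f j)^`M(v)) * 'X_v =
    \sum_(j | a j == v) r 0 j * tnth f j + \sum_(j | b j == v) r 0 j * tnth f j.
  rewrite mulr_suml [X in X + _]big_mkcond [X in _ + X]big_mkcond -big_split.
  apply: eq_bigr => j _ /=; rewrite fE mderivM.
  transitivity (r 0 j * (('X_(a j))^`M(v) * 'X_v * 'X_(b j) +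
      'X_(a j) * (('X_(b j))^`M(v) * 'X_v))); first by ring.
  by rewrite !dX; case: eqP => _; case: eqP => _ /=; ring.
split=> [hr v | hr v].
  have := euler v; rewrite hr mul0r.
  case cv: (col v).
    suff -> : \sum_(j | b j == v) r 0 j * tnth f j = 0 by rewrite addr0.
    by rewrite big1 // => j /eqP bj; rewrite -bj col_b in cv.
  suff -> : \sum_(j | a j == v) r 0 j * tnth f j = 0 by rewrite add0r.
  by rewrite big1 // => j /eqP aj; rewrite -aj col_a in cv.
have [ha hb] := hr v; apply/eqP; have := euler v; rewrite ha hb addr0 => /eqP.
by rewrite mulf_eq0 (negPf (mpolyX_neq0 _ _)) orbF.
Qed.

(** The edges of a path, taken alternately, form two monomials in the edge
    variables.  Evaluated at f, each is the product of the vertices of the path,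
    up to its two end vertices: if they have different colours, al covers both
    and be neither; if they have the same colour, al misses the last vertex and
    be the first.  The exponents, zero or one, express both cases at once, and
    prepending an edge e exchanges the roles of al and be. *)
Lemma alternating_path (S : pred 'I_m) (v : 'I_n) (p : seq 'I_n) :
    path (joined a b S) v p ->
  exists al be : 'X_{1..m},
    [/\ forall j, ~~ S j -> al j = 0%N /\ be j = 0%N,
        ('X_[al] \mPo f) * 'X_(last v p) ^+ (col v == col (last v p))
          = \prod_(x <- v :: p) 'X_x
      & ('X_[be] \mPo f) * 'X_v * 'X_(last v p) ^+ (col v != col (last v p))
          = \prod_(x <- v :: p) 'X_x].
Proof.
elim: p v => [|u p IH] v /=.
  move=> _; exists 0%MM, 0%MM; rewrite big_seq1 eqxx /= mpolyX0 comp_mpoly1.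
  by split=> [j _||]; rewrite ?mnm0E // ?mul1r // mulr1.
case/andP=> /existsP [e /andP [Se uv]] /IH [al [be [sup alE beE]]].
set z := last u p in alE beE *.
have col_uv : (col v == col z) = (col u != col z).
  by case/orP: uv => /andP [/eqP-> /eqP->]; rewrite col_a col_b; case: (col z).
have phi_e : ('X_[be + U_(e)] \mPo f) = ('X_[be] \mPo f) * ('X_v * 'X_u).
  rewrite mpolyXD rmorphM /= comp_mpolyXU -tnth_nth fE.
  by case/orP: uv => /andP [/eqP-> /eqP->] //; rewrite ['X_(b e) * _]mulrC.
exists (be + U_(e))%MM, al; split.
- move=> j Sj; have [alj bej] := sup j Sj; split=> //.
  by rewrite mnmDE bej mnm1E; case: eqP => // ej; rewrite -ej Se in Sj.
- by rewrite big_cons phi_e -beE col_uv; ring.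
by rewrite big_cons -alE col_uv negbK; ring.
Qed.

(** The path given by [connect_deleted_edge], made simple, is closed by j0; its
    ends have different colours, so j0 goes to the monomial missing both. *)
Lemma alternating_cycle (A : zmodType) (c : 'I_m -> A) (w : 'X_{1..n}) (j0 : 'I_m) :
    (forall v, \sum_(j | a j == v) c j = 0) ->
    (forall v, \sum_(j | b j == v) c j = 0) ->
    (forall j, c j != 0 -> (0 < w (a j))%N && (0 < w (b j))%N) -> c j0 != 0 ->
  exists (al be : 'X_{1..m}) (g : {mpoly k[n]}),
    [/\ 'X_[al] \mPo f = 'X_[be] \mPo f, 'X_[w] = g * ('X_[al] \mPo f),
        al j0 = 1%N /\ be j0 = 0%N
      & forall j, c j = 0 -> al j = 0%N /\ be j = 0%N].
Proof.
move=> ca cb cw c0.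
have /connectP [p0 path_p0 last_p0] := connect_deleted_edge ca cb c0.
case: (shortenP path_p0) last_p0 => p path_p uniq_p _ last_p {p0 path_p0}.
have [al [be [sup alE beE]]] := alternating_path path_p.
rewrite -last_p col_a col_b /= expr0 mulr1 in alE beE.
have be0 : be j0 = 0%N by apply: (sup j0 _).2; rewrite /= eqxx andbF.
exists (be + U_(j0))%MM, al.
have closed : 'X_[be + U_(j0)] \mPo f = 'X_[al] \mPo f.
  rewrite alE -beE mpolyXD rmorphM /= comp_mpolyXU -tnth_nth fE expr1.
  by rewrite ['X_(a j0) * _]mulrC mulrA.
(* Every vertex of the cycle is an end of an edge of nonzero weight. *)
have wp x : x \in b j0 :: p -> (0 < w x)%N.
  rewrite inE => /predU1P [->|xp]; first by case/andP: (cw _ c0).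
  have : exists y, joined a b [pred j | (c j != 0) && (j != j0)] y x.
    case/path.splitP: xp path_p => p1 p2; rewrite cat_path rcons_path.
    by case/andP=> /andP [_ h] _; exists (last (b j0) p1).
  case=> y /existsP [j /andP [/= /andP [/cw /andP [wa wb] _]]].
  by case/orP => /andP [_ /eqP ->].
have [g gE] := mprodX_uniq_dvd k uniq_p wp.
exists g; split=> // [|| j cj].
- by rewrite closed alE.
- split; first by rewrite mnmDE be0 mnm1E eqxx.
  by apply: (sup j0 _).1; rewrite /= eqxx andbF.
have [-> bej] : al j = 0%N /\ be j = 0%N by apply: sup; rewrite /= cj eqxx.
split=> //; rewrite mnmDE bej mnm1E; case: eqP => // jj0.
by rewrite jj0 cj eqxx in c0.
Qed.

(** By induction on the number of nonzero weights, each step cancelling one of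
    them with the gradient of an even cycle relation. *)
Lemma homogeneous_syzygy_polar (w : 'X_{1..n}) (c : 'I_m -> k) r :
    differential_syzygy f r ->
    (forall j, r 0 j * tnth f j = c j *: 'X_[w]) ->
  polar_syzygy f r.
Proof.
have [N] := ubnP #|[pred j | c j != 0]|.
elim: N c r => // N IH c r; rewrite ltnS => leN syz rE.
case: (pickP [pred j | c j != 0]) => [j0 /= c0 | /= c0]; last first.
  suff -> : r = 0 by exact: polar_syzygy0.
  apply/rowP => j; rewrite mxE; apply/eqP; have /eqP := rE j.
  move/negbFE/eqP: (c0 j) => ->.
  by rewrite scale0r mulf_eq0 (negPf (edge_monomial_neq0 j)) orbF.
have /differential_syzygy_incidence inc := syz.
have c_sum (P : pred 'I_m) : \sum_(j | P j) r 0 j * tnth f j = 0 ->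
    \sum_(j | P j) c j = 0.
  move=> h; apply/eqP; move/eqP: h; under eq_bigr => j _ do rewrite rE.
  by rewrite -scaler_suml scaler_eq0 (negPf (mpolyX_neq0 _ w)) orbF.
have ca v : \sum_(j | a j == v) c j = 0 by apply: c_sum; exact: (inc v).1.
have cb v : \sum_(j | b j == v) c j = 0 by apply: c_sum; exact: (inc v).2.
have cw j : c j != 0 -> (0 < w (a j))%N && (0 < w (b j))%N.
  move=> cj; have : w \in msupp (r 0 j * 'X_[U_(a j) + U_(b j)]).
    by rewrite mpolyXD -fE rE mcoeff_msupp mcoeffZ mcoeffX eqxx mulr1.
  rewrite (perm_mem (msuppMX _ _)) => /mapP [u _ ->].
  by rewrite !mnmDE !mnm1E !eqxx addn1 !addSn.
have [al [be [g [relE wE [al0 be0] sup]]]] := alternating_cycle ca cb cw c0.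
pose F : {mpoly k[m]} := 'X_[al] - 'X_[be].
have F0 : relation_ideal f F by rewrite /relation_ideal comp_mpolyB relE subrr.
pose h := (c j0 *: g) *: relation_gradient f F.
have polar_h : polar_syzygy f h by exact: polar_syzygy_gradient.
have polar_Nh : polar_syzygy f (- h).
  by rewrite -scaleNr; exact: polar_syzygy_gradient.
rewrite -[r](subrK h); apply: polar_syzygyD => //.
pose c' j := c j - c j0 * ((al j)%:R - (be j)%:R).
apply: (IH c').
- apply: leq_trans leN; apply: proper_card; apply/properP; split.
    apply/subsetP => j; rewrite !inE; apply: contraNneq => cj.
    by have [aj bj] := sup j cj; rewrite /c' cj aj bj subrr mulr0 subrr.
  by exists j0; rewrite !inE // /c' al0 be0 subr0 mulr1 subrr eqxx.
- by apply: differential_syzygyD => //; exact: polar_syzygy_differential.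
move=> j; rewrite !mxE mulrBl rE -mulrA mderivB comp_mpolyB mulrBl.
rewrite !mul_comp_mderivX -relE -scalerBl -scalerAr -scalerAl -wE.
by rewrite scalerA -scalerBl /c' [_ * c j0]mulrC.
Qed.

(** The incidence equations are linear over the scalars in the products
    q j = r_j f_j, so r splits into its homogeneous pieces: in piece w, the
    entries are those terms of r whose product with f_j has monomial X^w. *)
Lemma differential_syzygy_polar r : differential_syzygy f r -> polar_syzygy f r.
Proof.
move/differential_syzygy_incidence => inc.
pose q j := r 0 j * tnth f j; pose K := (\max_(j < m) msize (q j))%N.
pose piece (w : 'X_{1..n}) : 'rV[{mpoly k[n]}]_m :=
  \row_j ((q j)@_w *: 'X_[w - (U_(a j) + U_(b j))]).
have pieceE w j : piece w 0 j * tnth f j = (q j)@_w *: 'X_[w].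
  rewrite mxE fE -mpolyXD -scalerAl -mpolyXD.
  have [->|qw] := eqVneq ((q j)@_w) 0; first by rewrite !scale0r.
  rewrite submK //; move: qw; rewrite -mcoeff_msupp /q fE -mpolyXD.
  by rewrite (perm_mem (msuppMX _ _)) => /mapP [u _ ->]; exact: lem_addr.
have -> : r = \sum_(w : 'X_{1..n < K}) piece w.
  apply/rowP => j; apply: (mulIf (edge_monomial_neq0 j)).
  rewrite summxE mulr_suml; under [RHS]eq_bigr => w _ do rewrite pieceE.
  by apply: mpolywE; exact: (leq_bigmax (F := fun j => msize (q j))).
apply: polar_syzygy_sum => w.
apply: (@homogeneous_syzygy_polar w (fun j => (q j)@_w)) => //.
apply/differential_syzygy_incidence => v.
have sum_piece (P : pred 'I_m) : \sum_(j | P j) q j = 0 ->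
    \sum_(j | P j) piece w 0 j * tnth f j = 0.
  move/(congr1 (mcoeff w)); rewrite raddf_sum mcoeff0 /= => qP.
  under eq_bigr => j _ do rewrite pieceE.
  by rewrite -scaler_suml qP scale0r.
by split; apply: sum_piece; [exact: (inc v).1 | exact: (inc v).2].
Qed.

End BipartiteMonomials.

(** * Polarizability *)

Theorem corollary5p2 (k : fieldType) (n m : nat) (f : m.-tuple {mpoly k[n]})
  (char_k : [pchar k] =i pred0)
  (f_distinct : uniq f)
  (f_monomials : forall p, p \in f -> monomial_of_degree2 p)
  (f_connected : connected_graph (monomial_graph f))
  (f_bipartite : bipartite_graph (monomial_graph f)) :
  polarizable f.
Proof.
case: f_bipartite => col proper_col.
have ends j : exists e : 'I_n * 'I_n,
    (tnth f j == 'X_(e.1) * 'X_(e.2)) && (col e.1 && ~~ col e.2).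
  have [mu /mdeg2_mnm1D [x [y ->]]] := f_monomials _ (mem_tnth j f).
  rewrite mpolyXD => fj; have : col x != col y.
    by apply: proper_col; rewrite /monomial_graph -fj mem_tnth.
  case cx: (col x); case cy: (col y) => // _.
    by exists (x, y); rewrite /= fj eqxx cx cy.
  by exists (y, x); rewrite /= fj mulrC eqxx cx cy.
pose e j := xchoose (ends j).
have eP j := andP (xchooseP (ends j)).
move=> r; split; first exact: polar_syzygy_differential.
apply: (@differential_syzygy_polar _ _ _ _ (fun j => (e j).1) (fun j => (e j).2) col).
- by move=> j; apply/eqP; case: (eP j).
- by move=> j; case: (eP j) => _ /andP [].
by move=> j; case: (eP j) => _ /andP [_ /negPf].
Qed.
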